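(* Let $S$ be the long trap setting strategy (with any rule for choosing among several eligible seats), and let $c_S(n)$ be the expected number of diners who end up without a napkin when the maître d' follows $S$ at a circular table with $n$ seats. Then for every integer $n \ge 3$, $$c_S(n) = \frac{3n}{16} - \frac{3}{64} - \frac{\psi(n-3) + 3\psi(n-2)}{2^{n+3}}.$$
   Context: Adaptive maître d' problem: $n$ diners are to be seated at a circular table with $n$ seats; between each pair of consecutive seats lies one napkin. The maître d' seats the diners one at a time, each in an empty seat of his choice. When a diner sits down, they take a napkin adjacent to their seat that is still available: if both adjacent napkins are available they choose one uniformly at random, independently of everything else; if exactly one is available they take it; if none is available they get no napkin. The maître d' observes every napkin choice. An empty seat and an available napkin are neighbors if the napkin is adjacent to the seat. The long trap setting strategy $S$: (S1) if some available napkin neighbors exactly one empty seat, seat the next diner in that empty seat; (S2) otherwise (every available napkin neighbors zero or two empty seats), if there is an empty seat $X$ three seats away from an occupied seat with the two seats strictly between them both empty, seat the next diner in such an $X$; if there is no such seat, seat the next diner in any empty seat. The integer sequence $\psi$ is defined by $\psi(0)=1$, $\psi(1)=0$, and $\psi(n) = -2\psi(n-2) - \psi(n-1)$ for $n \ge 2$. *)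

(* Defs.v *)
From mathcomp Require Import all_boot all_order all_algebra.

Set Implicit Arguments.
Unset Strict Implicit.
Unset Printing Implicit Defensive.

Import Order.TTheory GRing.Theory Num.Theory.
Local Open Scope ring_scope.

(* Seats and napkins are both indexed by 'I_n, cyclically: napkin j lies      *)
(* between seat j and seat ordS j.                                            *)
Definition adjacent (n : nat) (x j : 'I_n) : bool := (x == j) || (x == ordS j).

(* One diner: the seat assigned and the napkin taken (None: no napkin).       *)
(* A history lists the diners in the order in which they were seated.         *)
Definition step (n : nat) : finType := ('I_n * option 'I_n)%type.
Definition history (n : nat) := seq (step n).

Definition empty_seat (n : nat) (h : history n) (x : 'I_n) : bool :=
  x \notin [seq p.1 | p <- h].

Definition available (n : nat) (h : history n) (j : 'I_n) : bool :=
  Some j \notin [seq p.2 | p <- h].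

Definition available_at (n : nat) (h : history n) (x : 'I_n) : {set 'I_n} :=
  [set j | available h j & adjacent x j].

Definition empty_neighbors (n : nat) (h : history n) (j : 'I_n) : {set 'I_n} :=
  [set x | empty_seat h x & adjacent x j].

(* Probability that the diner seated at x after history h ends up with y:     *)
(* uniform over the available adjacent napkins, None if there are none.       *)
Definition napkin_pr (R : realFieldType) (n : nat) (h : history n) (x : 'I_n)
    (y : option 'I_n) : R :=
  let A := available_at h x in
  if A == set0 then (y == None)%:R
  else if y is Some j then (j \in A)%:R / #|A|%:R else 0.

(* The maitre d' may randomize: s h x is the probability of choosing seat x   *)
(* after observing the history h.                                             *)
Definition strategy (R : realFieldType) (n : nat) := history n -> 'I_n -> R.

(* The condition is imposed on every list of fewer than n steps, including    *)
(* lists that never occur in play; this loses no generality, since fewer than *)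
(* n steps always leave an empty seat, and the values of s on lists that do   *)
(* not occur do not affect expected_napkinless. The same applies to           *)
(* follows_long_trap.                                                         *)
Definition is_strategy (R : realFieldType) (n : nat) (s : strategy R n) : Prop :=
  forall h : history n, (size h < n)%N ->
    [/\ forall x, 0 <= s h x,
        \sum_x s h x = 1
      & forall x, s h x != 0 -> empty_seat h x].

Definition outcome_pr (R : realFieldType) (n : nat) (s : strategy R n)
    (h : n.-tuple (step n)) : R :=
  \prod_(t < n)
    (s (take t h) (tnth h t).1
     * napkin_pr R (take t h) (tnth h t).1 (tnth h t).2).

Definition napkinless (n : nat) (h : history n) : nat :=
  count (fun p : step n => p.2 == None) h.

Definition expected_napkinless (R : realFieldType) (n : nat)
    (s : strategy R n) : R :=
  \sum_(h : n.-tuple (step n)) outcome_pr s h * (napkinless h)%:R.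

Definition forced_seats (n : nat) (h : history n) : {set 'I_n} :=
  [set x | empty_seat h x
         & [exists j, [&& available h j, adjacent x j
                        & #|empty_neighbors h j| == 1%N]]].

(* "Three seats away" is directional: x is reached from an occupied seat o by *)
(* three steps in one of the two directions, passing over two empty seats.    *)
Definition trap_seats (n : nat) (h : history n) : {set 'I_n} :=
  [set x | empty_seat h x
         & [exists o : 'I_n, ~~ empty_seat h o &&
             ([&& empty_seat h (ordS o), empty_seat h (ordS (ordS o))
                & x == ordS (ordS (ordS o))]
              || [&& empty_seat h (ord_pred o),
                     empty_seat h (ord_pred (ord_pred o))
                   & x == ord_pred (ord_pred (ord_pred o))])]].

Definition long_trap_seats (n : nat) (h : history n) : {set 'I_n} :=
  if forced_seats h != set0 then forced_seats h
  else if trap_seats h != set0 then trap_seats h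
  else [set x | empty_seat h x].

Definition follows_long_trap (R : realFieldType) (n : nat)
    (s : strategy R n) : Prop :=
  forall (h : history n) (x : 'I_n),
    (size h < n)%N -> s h x != 0 -> x \in long_trap_seats h.

Fixpoint psi (n : nat) : int :=
  match n with
  | 0%N => 1
  | 1%N => 0
  | (m.+1 as k).+1 => - 2%:Z * psi m - psi k
  end.

(* Main.v *)
Require Import Defs.
From mathcomp Require Import all_boot all_order all_algebra.
From mathcomp Require Import ring zify.
Import Order.TTheory GRing.Theory Num.Theory.
Set Implicit Arguments.
Unset Strict Implicit.
Unset Printing Implicit Defensive.
Local Open Scope ring_scope.

(* Cut the table at the occupied seats into runs of consecutive empty seats.  *)
(* Under S every run reached in play has all its inner napkins and at most    *)
(* one of its two end napkins. Let a_k (no end napkin) and b_k (one end       *)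
(* napkin) be the expected number of napkinless diners that a run of k seats  *)
(* still produces. Forced moves give b_k = (a_{k-1} + b_{k-1}) / 2 for k > 1, *)
(* traps give a_k = 3/4 + (a_{k-3} + b_{k-3}) / 2 = 3/4 + b_{k-2} for k > 3.  *)
(* Hence the napkinless diners so far plus the costs of all the runs form a   *)
(* martingale. The first diner leaves a run of n - 1 seats with one end       *)
(* napkin, so c_S(n) = b_{n-1}.                                               *)

(** The martingale rests on two facts about one seating. The shape of the runs persists
    ([regular_step]): in a run with an end napkin S moves only at that end, which leaves an empty
    part and one shorter run; in a run without end napkins both parts inherit a missing outer end.
    The costs balance ([run_cost_move]): a forced diner takes the end napkin or the inner one with
    equal odds, and a trap cuts off two seats, which cost 1 or 1/2, whence the constant 3/4.

    [long_trap_legal] shows that every seat S may choose is such a move, so ties may be broken in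
    any way. [potential_step] turns this into the martingale property, and [value_regular] iterates
    it to the full table, where the potential is 0. The closed form of b_k comes from solving the
    recurrence in [mp_cost_rec]. *)

Local Notation shift k o := (iter k (@ordS _) o).

(** * Cyclic shifts and runs of empty seats *)

Lemma shift_val (n : nat) (o : 'I_n) (k : nat) :
  (shift k o : nat) = ((o + k) %% n)%N.
Proof.
elim: k => [|k IHk] /=; first by rewrite addn0 modn_small.
by rewrite IHk -addn1 modnDml addn1 addnS.
Qed.

Lemma shift_id (n : nat) (o : 'I_n) : shift n o = o.
Proof. by apply: val_inj; rewrite /= shift_val modnDr modn_small. Qed.

Lemma shift_neq (n : nat) (o : 'I_n) (k : nat) :
  (0 < k < n)%N -> shift k o != o.
Proof.
case/andP=> k0 kn; apply/eqP => /(congr1 val) /=; rewrite shift_val => e.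
have : o + k == o + 0 %[mod n] by rewrite e addn0 modn_small.
by rewrite eqn_modDl mod0n modn_small // => /eqP k0'; rewrite k0' in k0.
Qed.

Lemma shift_inj (n k : nat) : injective (iter k (@ordS n)).
Proof. by elim: k => [|k IHk] o o' //= /ordS_inj /IHk. Qed.

Lemma shift_reach (n : nat) (o x : 'I_n) : exists k, shift k o = x.
Proof.
exists (x + (n - o))%N; apply: val_inj; rewrite /= shift_val.
rewrite addnCA subnKC; last exact: ltnW.
by rewrite modnDr modn_small.
Qed.

Definition run (n : nat) (E : pred 'I_n) (o : 'I_n) : nat :=
  find (fun i => ~~ E (shift i.+1 o)) (iota 0 n).

Lemma runP (n : nat) (E : pred 'I_n) (o : 'I_n) : ~~ E o ->
  [/\ (run E o < n)%N, ~~ E (shift (run E o).+1 o)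
    & forall i, (0 < i <= run E o)%N -> E (shift i o)].
Proof.
move=> Eo; have n0 : (0 < n)%N by apply: leq_ltn_trans (ltn_ord o).
have hasE : has (fun i => ~~ E (shift i.+1 o)) (iota 0 n).
  (* After [n] steps the walk is back at [o], which lies outside [E]. *)
  apply/hasP; exists n.-1; first by rewrite mem_iota ltn_predL.
  by rewrite prednK // shift_id.
have lt : (run E o < n)%N by move: hasE; rewrite has_find size_iota.
split=> //.
  by have := nth_find 0%N hasE; rewrite -/(run E o) nth_iota.
case=> // i /andP[_ iL].
have := before_find 0%N iL; rewrite nth_iota; last exact: ltn_trans lt.
by move/negbFE.
Qed.

Lemma run_end (n : nat) (E : pred 'I_n) (o : 'I_n) :
  ~~ E o -> ~~ E (shift (run E o).+1 o).
Proof. by case/runP. Qed.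

Lemma run_in (n : nat) (E : pred 'I_n) (o : 'I_n) (i : nat) :
  ~~ E o -> (0 < i <= run E o)%N -> E (shift i o).
Proof. by case/runP => _ _; apply. Qed.

Lemma run_eq (n : nat) (E : pred 'I_n) (o : 'I_n) (L : nat) : ~~ E o ->
  ~~ E (shift L.+1 o) ->
  (forall i, (0 < i <= L)%N -> E (shift i o)) -> run E o = L.
Proof.
move=> Eo EL Ei; case: (ltngtP (run E o) L) => // lt.
  by have := run_end Eo; rewrite Ei.
by move: EL; rewrite run_in.
Qed.

(** Cancelling the smaller shift would otherwise put the start of one run inside the other. With
    [run_cover] this makes the pairs (o, i), i at most [run E o], coordinates for the seats, and for
    the napkins, which carry the same indices. *)
Lemma run_inj (n : nat) (E : pred 'I_n) (o o' : 'I_n) (i i' : nat) :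
  ~~ E o -> ~~ E o' -> (i <= run E o)%N -> (i' <= run E o')%N ->
  shift i o = shift i' o' -> o = o' /\ i = i'.
Proof.
wlog le : o o' i i' / (i <= i')%N => [hw Eo Eo' iL iL' e|].
  case: (leqP i i') => le; first exact: hw.
  by case: (hw o' o i' i (ltnW le)).
move=> Eo Eo' _ iL'; rewrite -{1}(subnKC le) iterD => /shift_inj e.
case: (posnP (i' - i)) => d; last first.
  by move: Eo; rewrite e run_in // d /=; lia.
by rewrite d /= in e; split=> //; lia.
Qed.

(** Take [o] outside [E] at the least distance [m] behind [x]: if [m] exceeded the run of [o], the
    seat ending that run would be closer. *)
Lemma run_cover (n : nat) (E : pred 'I_n) (o1 x : 'I_n) : ~~ E o1 ->
  exists o i, [/\ ~~ E o, (i <= run E o)%N & x = shift i o].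
Proof.
move=> Eo1.
pose P m := [exists o, ~~ E o && (shift m o == x)].
have exP : exists m, P m.
  have [k ek] := shift_reach o1 x.
  by exists k; apply/existsP; exists o1; rewrite Eo1 ek eqxx.
case: (ex_minnP exP) => m /existsP[o /andP[Eo /eqP em]] minm.
exists o, m; split=> //; rewrite leqNgt; apply/negP => lt.
have /minm : P (m - (run E o).+1)%N.
  apply/existsP; exists (shift (run E o).+1 o).
  by rewrite run_end // -iterD subnK //= em.
by lia.
Qed.

Lemma run_seat (n : nat) (E E' : pred 'I_n) (o x : 'I_n) (i : nat) :
  (forall z, E' z = E z && (z != x)) -> ~~ E o -> (i < run E o)%N ->
  x = shift i.+1 o ->
  [/\ run E' o = i, run E' x = (run E o - i.+1)%N
    & forall o', ~~ E o' -> o' != o -> run E' o' = run E o'].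
Proof.
move=> E'E Eo iL ex.
have E'N z : ~~ E z -> ~~ E' z by rewrite E'E => /negbTE ->.
have E'x : ~~ E' x by rewrite E'E eqxx andbF.
split.
- apply: run_eq; [exact: E'N | by rewrite -ex |].
  move=> j /andP[j0 ji]; rewrite E'E run_in ?j0 //=; last exact: leq_trans (ltnW iL).
  apply/eqP; rewrite ex => /(run_inj Eo Eo) []; lia.
- apply: run_eq => //.
    by rewrite ex -iterD addSn subnK //; apply/E'N/run_end.
  move=> j /andP[j0 ji]; rewrite {1}ex -iterD E'E run_in //=; last by lia.
  by apply/eqP; rewrite ex => /(run_inj Eo Eo) []; lia.
- move=> o' Eo' no; apply: run_eq; [exact: E'N | exact/E'N/run_end |].
  move=> j /andP[j0 jL]; rewrite E'E run_in ?j0 //=.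
  apply/eqP; rewrite ex => /(run_inj Eo' Eo jL iL) [eo].
  by rewrite eo eqxx in no.
Qed.

(** The change is local: the napkin taken is next to [x], so every other nonempty run keeps its
    length and both end napkins, and empty runs contribute nothing. *)
Lemma sum_runs_seat (R : realFieldType) (n : nat) (g : nat -> bool -> bool -> R)
    (E E' A A' : pred 'I_n) (y : option 'I_n) (o x : 'I_n) (i : nat) :
  (forall s e, g 0%N s e = 0) ->
  (forall z, E' z = E z && (z != x)) ->
  (forall z, A' z = A z && (y != Some z)) ->
  ~~ E o -> (i < run E o)%N -> x = shift i.+1 o ->
  (forall z, y = Some z -> z = x \/ ordS z = x) ->
  \sum_(z | ~~ E' z) g (run E' z) (A' z) (A' (shift (run E' z) z)) =
  \sum_(z | ~~ E z) g (run E z) (A z) (A (shift (run E z) z))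
  - g (run E o) (A o) (A (shift (run E o) o))
  + g i (A' o) (A' (shift i o))
  + g (run E o - i.+1)%N (A' x) (A' (shift (run E o) o)).
Proof.
move=> g0 E'E A'A Eo iL ex yP.
have [ro rx ro'] := run_seat E'E Eo iL ex.
have Ex : E x by rewrite ex run_in.
have xo : o != x by apply: contraNneq Eo => ->.
rewrite (bigD1 x) /=; last by rewrite E'E eqxx andbF.
rewrite (bigD1 o) /=; last by rewrite E'E negb_and Eo.
have xend : shift (run E o - i.+1) x = shift (run E o) o.
  by rewrite ex -iterD subnK.
rewrite [in RHS](bigD1 o) //= ro rx xend.
rewrite (_ : \sum_(_ | _) _ =
  \sum_(z | ~~ E z && (z != o)) g (run E z) (A z) (A (shift (run E z) z))).
  by ring.
apply: eq_big => [z|z].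
  by rewrite E'E; case: (eqVneq z x) => [->|]; rewrite ?Ex ?andbT ?andbF.
rewrite E'E => /andP[/andP[]]; rewrite negb_and => Ez zx zo.
have {}Ez : ~~ E z by case/orP: Ez => //; rewrite negbK (negbTE zx).
rewrite ro' //; case: (posnP (run E z)) => [->|rz]; first by rewrite !g0.
have A'out w : w != x -> ordS w != x -> A' w = A w.
  move=> w1 w2; rewrite A'A; case: eqP => [yw|]; last by rewrite andbT.
  by case: (yP _ yw) => e; [rewrite e eqxx in w1 | rewrite e eqxx in w2].
have notin k : (k <= run E z)%N -> shift k z != x.
  move=> kL; apply/eqP; rewrite ex => /(run_inj Ez Eo kL iL) [e].
  by rewrite e eqxx in zo.
rewrite !A'out ?notin ?(notin 0%N) ?(notin 1%N) //.
apply/eqP => e; have := run_end Ez; rewrite /= e; exact/negP/negPn.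
Qed.

(** * Costs of runs and their recurrences *)

(* mp_cost is b_k, in closed form for k > 1, and mm_cost is a_k: each end     *)
(* napkin is m(issing) or p(resent).                                          *)
Definition mp_cost (R : realFieldType) (k : nat) : R :=
  if k is m.+2 then
    3%:R * (m + 3)%:R / 16%:R - 3%:R / 64%:R
    - (psi m + 3%:Z * psi m.+1)%:~R / 2%:R ^+ (m + 6)
  else 0.

Definition mm_cost (R : realFieldType) (k : nat) : R :=
  match k with
  | 0%N => 0
  | m.+4 => 3%:R / 4%:R + mp_cost R m.+2
  | _ => 1
  end.

Arguments mp_cost : simpl never.
Arguments mm_cost : simpl never.

(* Only used when l and r are not both true. *)
Definition run_cost (R : realFieldType) (k : nat) (l r : bool) : R :=
  if l || r then mp_cost R k else mm_cost R k.

Lemma run_cost0 (R : realFieldType) (l r : bool) : run_cost R 0 l r = 0.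
Proof. by rewrite /run_cost; case: (l || r). Qed.

Arguments psi : simpl never.

Lemma psiSS (m : nat) : psi m.+2 = - 2%:Z * psi m - psi m.+1.
Proof. by []. Qed.

(** For k > 2 this reads 2 b_{k+2} = 3/4 + b_{k+1} + b_{k-1}, with characteristic polynomial (x -
    1)(2x^2 + x + 1). The roots of the quadratic factor are half those of x^2 + x + 2, which belongs
    to [psi]; hence a linear part plus [psi] terms over powers of 2. *)
Lemma mp_cost_rec (R : realFieldType) (k : nat) :
  mp_cost R k.+2 = (mm_cost R k.+1 + mp_cost R k.+1) / 2%:R.
Proof.
have psi0 : psi 0 = 1 by [].
have psi1 : psi 1 = 0 by [].
case: k => [|[|[|k]]]; rewrite /mm_cost /mp_cost; last first.
  (* Everything is expressed through [psi k] and [psi k.+1]; the factors 8 and 4 absorb the extra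
     powers of 2. *)
  have -> : psi k.+3 + 3%:Z * psi k.+4 = 8%:Z * (psi k + psi k.+1).
    by rewrite !psiSS; ring.
  have -> : psi k.+2 + 3%:Z * psi k.+3 = 4%:Z * (psi k - psi k.+1).
    by rewrite !psiSS; ring.
  move: (psi k) (psi k.+1) => p q.
  rewrite !(intrD, rmorphN, intrM) /= -!pmulrn.
  have -> : (k.+3 + 3 = 3 + (k + 3))%N by lia.
  have -> : (k.+2 + 3 = 2 + (k + 3))%N by lia.
  have -> : (k.+3 + 6 = 3 + (k + 6))%N by lia.
  have -> : (k.+2 + 6 = 2 + (k + 6))%N by lia.
  rewrite !natrD !exprD.
  by field; rewrite expf_neq0 // pnatr_eq0.
all: by rewrite ?psiSS psi0 psi1; field.
Qed.

(* A necessary condition for S to pick the seat with index i < L in a run of  *)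
(* L seats whose left and right end napkins have availability l and r.        *)
Definition legal_move (L i : nat) (l r : bool) : bool :=
  [|| (i == 0)%N && l, (i.+1 == L) && r,
      [&& ~~ l, ~~ r, (2 < L)%N & (i == 2)%N || (i.+3 == L)]
    | [&& ~~ l, ~~ r & (L <= 2)%N]].

(** [pa] and [xa] tell whether the napkins left and right of the chosen seat are available, and
    [c p q] is the cost of the two parts once these napkins have status [p] and [q]. The branch with
    [1 +] arises only when [L] is 1. *)
Lemma run_cost_move (R : realFieldType) (L i : nat) (l r : bool) :
  (i < L)%N -> ~~ (l && r) -> legal_move L i l r ->
  let pa := if i == 0%N then l else true in
  let xa := if i.+1 == L then r else true in
  let c p q := run_cost R i l p + run_cost R (L - i.+1) q r in
  (if pa && xa then (c false xa + c pa false) / 2%:R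
   else if pa || xa then c false false else 1 + c false false)
  = run_cost R L l r.
Proof.
move=> iL nlr; rewrite /legal_move.
have [i0|i0] := eqVneq i 0%N.
  rewrite {}i0 in iL *; case: L iL => [|[|L]] // _; rewrite ?subSS ?subn0.
    by case: l r nlr => -[] //= _ _; rewrite /run_cost /mp_cost /mm_cost /= ?addr0 ?add0r.
  rewrite !run_cost0 /= !add0r; case: l nlr => /=.
    by move=> /negbTE -> _; rewrite /run_cost /= mp_cost_rec; field.
  move=> _; case: r => /=; first by case: L.
  by case: L => [|[|L]] //=; rewrite /run_cost /mm_cost /= ?addr0.
have [iL1|iL1] := eqVneq i.+1 L.
  rewrite -iL1 in nlr *; rewrite subnn !run_cost0 /= !addr0.
  case: r nlr => /=.
    rewrite andbT => /negbTE -> _; rewrite /run_cost /=.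
    by case: i i0 {iL iL1} => // i _; rewrite mp_cost_rec.
  case: l => //= _.
  case: i i0 {iL iL1} => [|[|[|i]]] //= _; lia.
rewrite /=; case: l nlr => //=; case: r => //= _ /orP[]; last by lia.
rewrite /run_cost /= => /andP[L2 /orP[/eqP i2|/eqP i3]].
  (* The two seats cut off cost [mm_cost] 2 = 1 or [mp_cost] 2 = 1/2, depending on the napkin
     taken. *)
  rewrite i2 in iL iL1 *; case: L iL iL1 L2 => [|[|[|[|L]]]] // _ _ _.
  rewrite !subSS subn0 [RHS]/mm_cost (mp_cost_rec R L).
  have -> : mp_cost R 2 = 1 / 2%:R by rewrite /mp_cost /=; field.
  by rewrite [mm_cost R 2]/mm_cost; field.
have -> : (L - i.+1 = 2)%N by lia.
rewrite -i3; case: i i0 {iL iL1 i3 L2} => // i _.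
rewrite [RHS]/mm_cost (mp_cost_rec R i).
have -> : mp_cost R 2 = 1 / 2%:R by rewrite /mp_cost /=; field.
by rewrite [mm_cost R 2]/mm_cost; field.
Qed.

(** * Expectations over one napkin choice and over a whole seating *)

Lemma big_option_split (R : realFieldType) (T : finType) (F : option T -> R) :
  \sum_y F y = F None + \sum_j F (Some j).
Proof.
rewrite (bigD1 None) //=; congr (_ + _).
rewrite (reindex_omap Some id) /=; last by case.
by apply: eq_bigl => j; rewrite eqxx.
Qed.

Lemma neq_ordS (n : nat) (x : 'I_n) : (1 < n)%N -> ordS x != x.
Proof. by move=> n1; apply: (shift_neq x (k := 1)). Qed.

(** Writing the seat as [ordS w] names its two napkins, [w] and [ordS w]. *)
Lemma sum_napkin_pr (R : realFieldType) (n : nat) (h : history n) (w : 'I_n)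
    (F : option 'I_n -> R) : (1 < n)%N ->
  \sum_y napkin_pr R h (ordS w) y * F y =
  if available h w && available h (ordS w)
  then (F (Some w) + F (Some (ordS w))) / 2%:R
  else if available h w then F (Some w)
  else if available h (ordS w) then F (Some (ordS w)) else F None.
Proof.
move=> n1; have wx := neq_ordS w n1.
have AE j : (j \in available_at h (ordS w)) =
    ((j == w) && available h w) || ((j == ordS w) && available h (ordS w)).
  rewrite !inE /adjacent (inj_eq (@ordS_inj n)) andbC !(eq_sym _ j).
  case: (eqVneq j w) => [->|_]; first by rewrite [w == _]eq_sym (negbTE wx) orbF.
  by rewrite orbF; case: (eqVneq j (ordS w)) => [->|].
rewrite big_option_split /napkin_pr.
have key (A : {set 'I_n}) : available_at h (ordS w) = A -> A != set0 ->
    (if available_at h (ordS w) == set0 then (None == None :> option 'I_n)%:R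
     else 0) * F None
    + \sum_j (if available_at h (ordS w) == set0 then (Some j == None)%:R
       else (j \in available_at h (ordS w))%:R / #|available_at h (ordS w)|%:R)
       * F (Some j) = (\sum_(j in A) F (Some j)) / #|A|%:R.
  move=> -> /negbTE ->; rewrite mul0r add0r mulr_suml [RHS]big_mkcond /=.
  by apply: eq_bigr => j _; case: (j \in A); rewrite ?mul0r ?mul1r // mulrC.
case aw: (available h w); case ax: (available h (ordS w)); rewrite aw ax in AE.
- rewrite (key [set w; ordS w]); first last.
  + by apply/set0Pn; exists w; rewrite !inE eqxx.
  + by apply/setP => j; rewrite AE !inE !andbT.
  rewrite cards2 eq_sym wx big_setU1 ?big_set1 //.
  by rewrite inE eq_sym.
- rewrite (key [set w]); first last.
  + by apply/set0Pn; exists w; rewrite !inE eqxx.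
  + by apply/setP => j; rewrite AE !inE andbT andbF orbF.
  by rewrite cards1 big_set1 divr1.
- rewrite (key [set ordS w]); first last.
  + by apply/set0Pn; exists (ordS w); rewrite !inE eqxx.
  + by apply/setP => j; rewrite AE !inE andbT andbF.
  by rewrite cards1 big_set1 divr1.
- have -> : available_at h (ordS w) = set0.
    by apply/setP => j; rewrite AE !inE !andbF.
  by rewrite eqxx mul1r big1 ?addr0 // => j _; rewrite mul0r.
Qed.

Fixpoint value (R : realFieldType) (n : nat) (s : strategy R n) (k : nat)
    (h : history n) : R :=
  if k is k'.+1 then
    \sum_x s h x * \sum_y napkin_pr R h x y * value s k' (rcons h (x, y))
  else (napkinless h)%:R.

(** The arbitrary prefix [h] lets the induction move the first diner of the tuple into the
    history. *)
Lemma value_tuple (R : realFieldType) (n : nat) (s : strategy R n) (k : nat)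
    (h : history n) :
  \sum_(t : k.-tuple (step n))
     (\prod_(i < k) (s (h ++ take i t) (tnth t i).1
        * napkin_pr R (h ++ take i t) (tnth t i).1 (tnth t i).2))
     * (napkinless (h ++ t))%:R = value s k h.
Proof.
elim: k h => [|k IHk] h /=.
  rewrite (bigD1 [tuple]) //= big_ord0 mul1r cats0 big1 ?addr0 // => t.
  by case/eqP; apply: tuple0.
transitivity (\sum_(p : step n) s h p.1 * (napkin_pr R h p.1 p.2
    * value s k (rcons h (p.1, p.2)))); last first.
  by under [RHS]eq_bigr => x _ do rewrite mulr_sumr; rewrite pair_bigA.
under [RHS]eq_bigr => p _ do rewrite -IHk !mulr_sumr.
rewrite pair_bigA /=.
rewrite (reindex (fun p : step n * k.-tuple (step n) => [tuple of p.1 :: p.2])) /=.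
  apply: eq_bigr => -[p t] _ /=.
  rewrite big_ord_recl /= cats0 tnth0 -surjective_pairing cat_rcons !mulrA.
  congr (_ * _ * _); apply: eq_bigr => i _.
  by rewrite tnthS /= cat_rcons.
exists (fun t : k.+1.-tuple (step n) => (thead t, [tuple of behead t])).
  by move=> [p t] _; congr pair; apply: val_inj.
by move=> t _; apply: val_inj => /=; rewrite [in RHS](tuple_eta t).
Qed.

Lemma expected_napkinlessE (R : realFieldType) (n : nat) (s : strategy R n) :
  expected_napkinless s = value s n [::].
Proof. by rewrite -value_tuple. Qed.

(** * The potential and the invariant of play *)

Definition potential (R : realFieldType) (n : nat) (h : history n) : R :=
  \sum_(o | ~~ empty_seat h o)
    run_cost R (run (empty_seat h) o) (available h o)
      (available h (shift (run (empty_seat h) o) o)).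

(** Holds from the first diner on. The last field concerns nonempty runs only: in an empty run both
    ends are the same napkin, which may be left over between two occupied seats. *)
Record regular (n : nat) (h : history n) : Prop := Regular {
  regular_uniq : uniq [seq p.1 | p <- h];
  regular_seated : exists o, ~~ empty_seat h o;
  regular_inner : forall o i, ~~ empty_seat h o ->
    (0 < i < run (empty_seat h) o)%N -> available h (shift i o);
  regular_ends : forall o, ~~ empty_seat h o -> (0 < run (empty_seat h) o)%N ->
    ~~ (available h o && available h (shift (run (empty_seat h) o) o)) }.

Lemma empty_seat_rcons (n : nat) (h : history n) (x : 'I_n) (y : option 'I_n) z :
  empty_seat (rcons h (x, y)) z = empty_seat h z && (z != x).
Proof. by rewrite /empty_seat map_rcons mem_rcons inE negb_or andbC. Qed.

Lemma available_rcons (n : nat) (h : history n) (x : 'I_n) (y : option 'I_n) z :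
  available (rcons h (x, y)) z = available h z && (y != Some z).
Proof.
by rewrite /available map_rcons mem_rcons inE negb_or andbC [_ == y]eq_sym.
Qed.

Lemma card_empty_neighbors (n : nat) (h : history n) (j : 'I_n) : (1 < n)%N ->
  #|empty_neighbors h j| = (empty_seat h j + empty_seat h (ordS j))%N.
Proof.
move=> n1; have wx := neq_ordS j n1.
rewrite -sum1_card.
rewrite (eq_bigl (fun x => (x \in [set j; ordS j]) && empty_seat h x)); last first.
  by move=> x; rewrite !inE andbC.
rewrite big_mkcondr big_setU1 ?big_set1 /=; last by rewrite inE eq_sym.
by do 2!case: empty_seat.
Qed.

(** * The moves of S in terms of runs *)

Lemma forced_seatsP (n : nat) (h : history n) (x : 'I_n) : (1 < n)%N ->
  x \in forced_seats h ->
  exists2 j, available h j &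
    (x = j /\ ~~ empty_seat h (ordS j)) \/ (x = ordS j /\ ~~ empty_seat h j).
Proof.
move=> n1; rewrite inE => /andP[Ex /existsP[j /and3P[aj adj]]].
rewrite card_empty_neighbors // => c1; exists j => //.
case/orP: adj => /eqP e; [left | right]; split=> //; move: c1; rewrite -?e Ex;
  by case: empty_seat.
Qed.

Lemma forced_seat0 (n : nat) (h : history n) (j : 'I_n) : (1 < n)%N ->
  forced_seats h = set0 -> empty_seat h j != empty_seat h (ordS j) ->
  ~~ available h j.
Proof.
move=> n1 F0 ne; apply/negP => aj.
pose x := if empty_seat h j then j else ordS j.
have : x \in forced_seats h.
  rewrite inE; apply/andP; split.
    by rewrite /x; case: ifP ne => // _; case: empty_seat.
  apply/existsP; exists j; rewrite aj card_empty_neighbors // /adjacent.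
  have -> : (x == j) || (x == ordS j).
    by rewrite /x; case: ifP => _; rewrite eqxx ?orbT.
  by move: ne; do 2!case: empty_seat.
by rewrite F0 inE.
Qed.

Lemma run_endS (n : nat) (h : history n) (o : 'I_n) : (1 < n)%N ->
  ~~ empty_seat h o -> (0 < run (empty_seat h) o)%N -> forced_seats h = set0 ->
  ~~ available h o /\ ~~ available h (shift (run (empty_seat h) o) o).
Proof.
move=> n1 Eo r0 F0; split; apply: forced_seat0 => //.
  by rewrite (negbTE Eo) (run_in (i := 1)).
by rewrite run_in ?r0 //= -[ordS _]/(shift _.+1 o) (negbTE (run_end Eo)).
Qed.

(** A forced seat is the end of a run beside an available end napkin. If there is none, all nonempty
    runs lack both end napkins, and a trap seat is third from one end of its run. *)
Lemma long_trap_legal (n : nat) (h : history n) (x : 'I_n) : (1 < n)%N ->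
  (exists o, ~~ empty_seat h o) -> x \in long_trap_seats h ->
  exists o i, [/\ ~~ empty_seat h o, (i < run (empty_seat h) o)%N,
    x = shift i.+1 o
    & legal_move (run (empty_seat h) o) i (available h o)
        (available h (shift (run (empty_seat h) o) o))].
Proof.
move=> n1 [o1 Eo1] xS.
have Ex : empty_seat h x.
  by move: xS; rewrite /long_trap_seats; do 2?case: ifP => _; rewrite inE => // /andP[].
have [o [i' [Eo iL ex]]] := run_cover x Eo1.
case: i' iL ex => [_ ex|i iL ex]; first by rewrite ex (negbTE Eo) in Ex.
exists o, i; split=> //; rewrite /legal_move.
have nextE : (i.+1 == run (empty_seat h) o) = ~~ empty_seat h (ordS x).
  rewrite ex -[ordS _]/(shift i.+2 o).
  apply/eqP/idP => [->|]; first exact: run_end.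
  by move=> N; apply/eqP; rewrite eqn_leq iL leqNgt; apply: contra N => lt;
     apply: run_in.
have prevE : (i == 0)%N = ~~ empty_seat h (shift i o).
  by case: (posnP i) => [->|i0]; rewrite ?Eo // run_in // i0 ltnW.
move: xS; rewrite /long_trap_seats; case: ifP => [_|/negbFE/eqP F0].
  move=> /(forced_seatsP n1) [j aj [[xj Ej]|[xj Ej]]].
    have iL1 : i.+1 = run (empty_seat h) o by apply/eqP; rewrite nextE xj.
    by rewrite -iL1 eqxx -ex xj aj orbT.
  have ej : j = shift i o by apply: (@ordS_inj n); rewrite -xj ex.
  have i0 : i = 0%N by apply/eqP; rewrite prevE -ej.
  by rewrite i0 in ej *; rewrite -[o]/(shift 0 o) -ej aj.
have r0 : (0 < run (empty_seat h) o)%N by apply: leq_trans iL.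
have [/negbTE -> /negbTE ->] := run_endS n1 Eo r0 F0; rewrite /= !andbF /=.
case: ifP => [_|/negbFE/eqP T0].
  rewrite inE => /andP[_ /existsP[o' /andP[Eo']]].
  have long (z : 'I_n) : ~~ empty_seat h z -> empty_seat h (ordS z) ->
      empty_seat h (ordS (ordS z)) -> empty_seat h (ordS (ordS (ordS z))) ->
      (2 < run (empty_seat h) z)%N.
    move=> Ez E1 E2 E3; have := run_end Ez.
    by case: run => [|[|[|k]]] //=; rewrite ?E1 ?E2 ?E3.
  case/orP=> /and3P[E1 E2 /eqP e].
    rewrite e in Ex; have L3 := long _ Eo' E1 E2 Ex.
    have [eo ei] := run_inj Eo' Eo L3 iL (etrans (esym e) ex).
    by rewrite -eo L3; case: ei => <-; rewrite eqxx.
  have e1 : ordS x = ord_pred (ord_pred o') by rewrite e ord_predK.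
  have e2 : ordS (ordS x) = ord_pred o' by rewrite e1 ord_predK.
  have e3 : ordS (ordS (ordS x)) = o' by rewrite e2 ord_predK.
  (* Here [o'] closes the run, so [x] is third from its right end. *)
  have rE : run (empty_seat h) o = i.+3.
    apply: run_eq => //; first by rewrite /= -[ordS (shift i o)]/(shift i.+1 o) -ex e3.
    move=> j /andP[j0 ji]; case: (leqP j i.+1) => [ji1|ji1].
      by apply: run_in => //; rewrite j0 (leq_trans ji1).
    have : (j == i.+2) || (j == i.+3) by lia.
    case/orP => /eqP ->; rewrite /= -[ordS (shift i o)]/(shift i.+1 o) -ex.
      by rewrite e1.
    by rewrite e2.
  by rewrite rE eqxx orbT.
(* Without trap seats no run is longer than 2, since its third seat would be one. *)
move=> _; rewrite orbC; case: leqP => //= L3.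
have : shift 3 o \in trap_seats h.
  rewrite inE run_in //=; apply/existsP; exists o; rewrite Eo /=.
  rewrite -[ordS o]/(shift 1 o) -[ordS (shift 1 o)]/(shift 2 o).
  by rewrite !run_in ?eqxx // ltnW // ltnW.
by rewrite T0 inE.
Qed.

(** * One diner: the invariant and the martingale property *)

Lemma regular_step (R : realFieldType) (n : nat) (h : history n) (o x : 'I_n)
    (i : nat) (y : option 'I_n) :
  let L := run (empty_seat h) o in
  let l := available h o in
  let r := available h (shift L o) in
  let pa := available h (shift i o) && (y != Some (shift i o)) in
  let xa := available h x && (y != Some x) in
  regular h -> ~~ empty_seat h o -> (i < L)%N -> x = shift i.+1 o ->
  legal_move L i l r ->
  (forall z, y = Some z -> z = x \/ ordS z = x) ->
  regular (rcons h (x, y)) /\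
  potential R (rcons h (x, y)) = potential R h - run_cost R L l r
    + run_cost R i l pa + run_cost R (L - i.+1) xa r.
Proof.
move=> L l r pa xa [hu hs hin hends] Eo iL ex legal yP.
have Ex : empty_seat h x by rewrite ex run_in.
have E'E := empty_seat_rcons h x y.
have A'A := available_rcons h x y.
have [ro rx ro'] := run_seat E'E Eo iL ex.
have yo z k : ~~ empty_seat h z -> (k <= run (empty_seat h) z)%N ->
    y = Some (shift k z) -> z = o /\ (k = i \/ k = i.+1).
  move=> Ez kz /yP [e|e].
    rewrite ex in e; have [-> ->] := run_inj Ez Eo kz iL e.
    by split=> //; right.
  rewrite ex /= in e; move/ordS_inj: e => e.
  have [-> ->] := run_inj Ez Eo kz (ltnW iL) e.
  by split=> //; left.
have keep z k : ~~ empty_seat h z -> (k <= run (empty_seat h) z)%N ->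
    ~ (z = o /\ (k = i \/ k = i.+1)) ->
    available (rcons h (x, y)) (shift k z) = available h (shift k z).
  move=> Ez kz nk; rewrite A'A; case: eqP; rewrite ?andbT //.
  by move=> /(yo _ _ Ez kz).
have A'h z : available (rcons h (x, y)) z -> available h z.
  by rewrite A'A => /andP[].
have xend k : shift k x = shift (k + i.+1) o by rewrite ex -iterD.
have E'P z : ~~ empty_seat (rcons h (x, y)) z ->
    z = x \/ ~~ empty_seat h z.
  by rewrite E'E negb_and negbK => /orP[->|/eqP ->]; [right | left].
have rle : (L - i.+1 + i.+1)%N = L by rewrite subnK.
split.
  split.
  - rewrite map_rcons rcons_uniq hu andbT; exact: Ex.
  - by exists x; rewrite E'E eqxx andbF.
  - move=> z j /E'P [->|Ez].
      rewrite rx xend => /andP[j0 jL].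
      have [j1 j2 j3] : [/\ (0 < j + i.+1 < L)%N, j + i.+1 <> i & j + i.+1 <> i.+1]%N.
        by clear - j0 jL iL; split; lia.
      rewrite (keep o _ Eo); first exact: hin.
        by case/andP: j1 => _ /ltnW.
      by move=> [_ []].
    have [->|zo] := eqVneq z o.
      rewrite ro => /andP[j0 ji].
      have [j1 j2 j3] : [/\ (0 < j < L)%N, j <> i & j <> i.+1]%N.
        by clear - j0 ji iL; split; lia.
      rewrite (keep o _ Eo); first exact: hin.
        by case/andP: j1 => _ /ltnW.
      by move=> [_ []].
    rewrite ro' // => jr; rewrite keep //; first exact: hin.
      by case/andP: jr => _ /ltnW.
    by move=> [/eqP]; rewrite (negbTE zo).
  - move=> z /E'P [->|Ez].
      rewrite rx xend rle => r0; apply/negP => /andP[/A'h ax /A'h ar].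
      (* An available right end excludes the left one, so legality puts [x] last in the run and the
         right part is empty. *)
      have er : r = true by [].
      have := hends o Eo (leq_ltn_trans (leq0n i) iL).
      rewrite -/L -/l -/r er andbT => /negbTE el.
      move: legal; rewrite /legal_move el er andbF andbT /= orbF => /eqP.
      by clear - r0; lia.
    have [->|zo] := eqVneq z o.
      rewrite ro => i0; apply/negP => /andP[/A'h ao _].
      have el : l = true by [].
      have := hends o Eo (leq_ltn_trans (leq0n i) iL).
      rewrite -/L -/l -/r el /= => /negbTE er.
      move: legal; rewrite /legal_move el er andbF andbT /= orbF => /eqP.
      by clear - i0; lia.
    rewrite ro' // => r0; apply: contra (hends z Ez r0).
    by case/andP => /A'h -> /A'h ->.
rewrite /potential (sum_runs_seat (@run_cost0 R) E'E A'A Eo iL ex yP) -/L -/l -/r.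
congr (_ + _ + _).
  case: (posnP i) => [i0|i0]; first by rewrite {1 3}i0 !run_cost0.
  have -> : available (rcons h (x, y)) o = l.
    by apply: (keep o 0%N Eo) => // -[_ []]; clear - i0; lia.
  by rewrite A'A.
case: (posnP (L - i.+1)) => [->|L0]; first by rewrite !run_cost0.
have -> : available (rcons h (x, y)) (shift L o) = r.
  by apply: (keep o L Eo) => // -[_ []]; clear - L0; lia.
by rewrite A'A.
Qed.

(** [F] stands for the value after the diner's choice, which the induction in [value_regular]
    supplies only at regular histories. *)
Lemma potential_step (R : realFieldType) (n : nat) (h : history n) (x : 'I_n)
    (F : option 'I_n -> R) :
  (1 < n)%N -> regular h -> x \in long_trap_seats h ->
  (forall y, regular (rcons h (x, y)) ->
     F y = (napkinless (rcons h (x, y)))%:R + potential R (rcons h (x, y))) ->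
  \sum_y napkin_pr R h x y * F y = (napkinless h)%:R + potential R h.
Proof.
move=> n1 hreg xS FE.
have [o [i [Eo iL ex legal]]] := long_trap_legal n1 (regular_seated hreg) xS.
have step y := regular_step R hreg Eo iL ex legal (y := y).
set L := run _ _ in iL legal step; set l := available h o in legal step.
set r := available h (shift L o) in legal step.
have ends : ~~ (l && r).
  by apply: (regular_ends hreg) => //; apply: leq_ltn_trans iL.
have aw : available h (shift i o) = if i == 0%N then l else true.
  case: (posnP i) => [-> //|i0].
  by apply: (regular_inner hreg) => //; rewrite i0.
have ax : available h (ordS (shift i o)) = if i.+1 == L then r else true.
  case: (eqVneq i.+1 L) => [e|ne]; first by rewrite /r -e.
  by apply: (regular_inner hreg Eo (i := i.+1)); rewrite /= [(_ < _)%N]ltn_neqAle ne iL.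
have exS : x = ordS (shift i o) by [].
have main := run_cost_move R iL ends legal.
have nw := neq_ordS (shift i o) n1.
have nl y : napkinless (rcons h (x, y)) = (napkinless h + (y == None))%N.
  by rewrite /napkinless -cats1 count_cat /= addn0.
have FS z : (z = x \/ ordS z = x) -> F (Some z) = (napkinless h)%:R
    + (potential R h - run_cost R L l r
      + run_cost R i l (available h (shift i o) && (z != shift i o))
      + run_cost R (L - i.+1) (available h x && (z != x)) r).
  move=> zP; have [|reg e] := step (Some z); first by move=> w [<-].
  by rewrite FE // nl addn0 e.
have FN : F None = (napkinless h)%:R + 1
    + (potential R h - run_cost R L l r
      + run_cost R i l (available h (shift i o))
      + run_cost R (L - i.+1) (available h x) r).
  have [//|reg e] := step None.
  by rewrite FE // nl natrD e !andbT.
rewrite {1}exS sum_napkin_pr // -exS FS; last by right.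
rewrite FS; last by left.
rewrite FN exS !eqxx [shift i o == _]eq_sym nw /= !andbT !andbF.
rewrite -main aw ax; case: (if i == 0%N then l else true);
  case: (if i.+1 == L then r else true) => /=; by field.
Qed.

(** * From one diner to the whole table *)

Lemma potential_all_seated (R : realFieldType) (n : nat) (h : history n) :
  uniq [seq p.1 | p <- h] -> size h = n -> potential R h = 0.
Proof.
move=> hu hn; have seated o : ~~ empty_seat h o.
  rewrite negbK; have [] := @uniq_min_size _ _ (enum 'I_n) hu.
  - by move=> z _; rewrite mem_enum.
  - by rewrite size_enum_ord size_map hn.
  by move=> _ ->; rewrite mem_enum.
rewrite /potential big1 // => o Eo; rewrite (_ : run _ o = 0%N) ?run_cost0 //.
by apply: run_eq => // -[|i] // _; rewrite leqn0.
Qed.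

Lemma value_regular (R : realFieldType) (n : nat) (s : strategy R n) (k : nat)
    (h : history n) : (1 < n)%N -> is_strategy s -> follows_long_trap s ->
  regular h -> (size h + k)%N = n ->
  value s k h = (napkinless h)%:R + potential R h.
Proof.
move=> n1 hs hS; elim: k h => [|k IHk] h hreg hn /=.
  rewrite addn0 in hn.
  by rewrite potential_all_seated ?addr0 //; apply: regular_uniq.
have hlt : (size h < n)%N by rewrite -[X in (_ < X)%N]hn -addSnnS leq_addr.
have [_ s1 _] := hs h hlt.
rewrite -[RHS]mul1r -[X in X * (_ + _)]s1 mulr_suml; apply: eq_bigr => x _.
have [->|sx] := eqVneq (s h x) 0; first by rewrite !mul0r.
congr (_ * _). apply: potential_step => //; first exact: hS.
by move=> y yreg; apply: IHk; rewrite // size_rcons addSnnS.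
Qed.

(** The only run goes round the table from [x] back to [x]; its end napkins are the two beside [x],
    and [j] is one of them. *)
Lemma regular_first (R : realFieldType) (n : nat) (x j : 'I_n) : (1 < n)%N ->
  j = x \/ ordS j = x ->
  regular [:: (x, Some j)] /\ potential R [:: (x, Some j)] = mp_cost R n.-1.
Proof.
move=> n1 jx; set h := [:: _].
have EE z : empty_seat h z = (z != x) by rewrite /empty_seat inE.
have AE z : available h z = (z != j) by rewrite /available inE.
have Ex : ~~ empty_seat h x by rewrite EE eqxx.
have n0 : (0 < n)%N by apply: ltnW.
have rx : run (empty_seat h) x = n.-1.
  apply: run_eq => //; first by rewrite prednK // shift_id.
  move=> i /andP[i0 iN]; rewrite EE; apply: shift_neq; rewrite i0 /=.
  by rewrite -(prednK n0) ltnS.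
have last_pred : ordS (shift n.-1 x) = x.
  by rewrite -[ordS _]/(shift n.-1.+1 x) prednK // shift_id.
have EP z : ~~ empty_seat h z -> z = x by rewrite EE negbK => /eqP.
split.
  split=> //; first by exists x.
    move=> z i /EP ->; rewrite rx AE => /andP[i0 iN].
    have iS : (i.+1 < n)%N by rewrite -(prednK n0) ltnS.
    case: jx => [->|<-]; first by apply: shift_neq; rewrite i0 ltnW.
    apply/eqP => /(congr1 (@ordS n)).
    move/eqP; apply/negP; rewrite -[ordS (shift _ _)]/(shift i.+1 (ordS j)).
    exact: shift_neq.
  move=> z /EP ->; rewrite rx !AE => _.
  case: jx => [->|e]; first by rewrite eqxx.
  have -> : shift n.-1 x = j by apply: (@ordS_inj n); rewrite last_pred.
  by rewrite eqxx andbF.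
rewrite /potential (big_pred1 x); last by move=> z; rewrite EE negbK.
rewrite rx !AE /run_cost; case: ifP => // /negbT.
rewrite negb_or !negbK => /andP[/eqP xj /eqP e].
have := neq_ordS j n1; rewrite -{1}e last_pred -xj.
by rewrite eqxx.
Qed.

Theorem theorem1p2 (R : realFieldType) (n : nat) (hn : (3 <= n)%N)
    (s : strategy R n) (hs : is_strategy s) (hS : follows_long_trap s) :
  expected_napkinless s =
    3%:R * n%:R / 16%:R - 3%:R / 64%:R
    - (psi (n - 3) + 3%:Z * psi (n - 2))%:~R / 2%:R ^+ (n + 3).
Proof.
rewrite expected_napkinlessE; transitivity (mp_cost R n.-1); last first.
  case: n hn {s hs hS} => [|[|[|m]]] // _; rewrite -[m.+3.-1]/m.+2 !subSS !subn0 /mp_cost.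
  have -> : (m + 6 = m.+3 + 3)%N by lia.
  by have -> : (m + 3 = m.+3)%N by lia.
have n1 : (1 < n)%N by apply: ltnW.
have [_ s1 _] := hs [::] (ltnW n1).
rewrite -[X in value s X _](prednK (ltnW n1)) /= -[RHS]mul1r -s1 mulr_suml.
apply: eq_bigr => x _; congr (_ * _).
(* The empty table has no occupied seat and is not [regular], so the first diner is treated apart;
   both napkins lead to the same cost. *)
have first j : j = x \/ ordS j = x ->
    value s n.-1 [:: (x, Some j)] = mp_cost R n.-1.
  move=> jx; have [reg pot] := regular_first R n1 jx.
  by rewrite value_regular //= ?add0r // add1n prednK // ltnW.
have xw : x = ordS (ord_pred x) by rewrite ord_predK.
rewrite {1}xw sum_napkin_pr //= -xw !first ?ord_predK; [|by left|by right].
by field.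
Qed.
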